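(* The class of contact segment graphs has unbounded local tree-independence number. That is, there is no function $f\colon\mathbb{N}\to\mathbb{N}$ such that for every $r\in\mathbb{N}$, every contact segment graph $G$, and every $v\in V(G)$, the subgraph of $G$ induced by the set $N^r[v]$ of vertices at distance at most $r$ from $v$ has tree-independence number at most $f(r)$.
   Context: All graphs are finite and simple. A contact segment graph is the intersection graph of a finite set of line segments in $\mathbb{R}^2$ with pairwise disjoint interiors, where the interior of a segment is the segment minus its two endpoints (vertices are the segments, two distinct ones adjacent iff they intersect). A tree decomposition of $G$ is a pair $(T,\{X_t\}_{t\in V(T)})$ with $T$ a tree and bags $X_t\subseteq V(G)$ such that every vertex is in some bag, both endpoints of every edge lie in a common bag, and for each $u\in V(G)$ the nodes $t$ with $u\in X_t$ induce a connected subgraph of $T$. Its independence number is $\max_t\alpha(G[X_t])$, with $\alpha$ the independence number of a graph. The tree-independence number of $G$ is the minimum independence number of a tree decomposition of $G$. *)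

(* Defs.v *)
From mathcomp Require Import all_boot all_order all_algebra.
From mathcomp Require Import boolp classical_sets reals.

Set Implicit Arguments.
Unset Strict Implicit.
Unset Printing Implicit Defensive.

Import Order.TTheory GRing.Theory Num.Theory.

Record graph := Graph {
  vertex :> finType;
  edge : rel vertex;
  edge_sym : symmetric edge;
  edge_irrefl : irreflexive edge }.

Section Induced.
Variables (G : graph) (A : {set G}).

Definition induced_edge : rel {x : G | x \in A} :=
  fun x y => edge (val x) (val y).

Lemma induced_edge_sym : symmetric induced_edge.
Proof. by move=> x y; exact: edge_sym. Qed.

Lemma induced_edge_irrefl : irreflexive induced_edge.
Proof. by move=> x; exact: edge_irrefl. Qed.

Definition induced : graph := Graph induced_edge_sym induced_edge_irrefl.

End Induced.

Definition stable (G : graph) (S : {set G}) : bool :=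
  [forall x in S, forall y in S, ~~ edge x y].

Definition alpha (G : graph) : nat := \max_(S : {set G} | stable S) #|S|.

(* An n.-bseq is a sequence of length at most n, and size p is the number of
   edges of the walk v :: p. *)
Definition ball (G : graph) (r : nat) (v : G) : {set G} :=
  [set u | [exists p : r.-bseq G, path (@edge G) v p && (last v p == u)]].

Definition connected_graph (G : graph) : Prop :=
  forall x y : G, connect (@edge G) x y.

(* A ucycle of size 2 merely goes back and forth along one edge. *)
Definition acyclic (G : graph) : Prop :=
  forall c : seq G, ucycle (@edge G) c -> size c <= 2.

Definition is_tree (G : graph) : Prop :=
  [/\ 0 < #|G|, connected_graph G & acyclic G].

Record tree_decomposition (G : graph) := TreeDecomposition {
  td_tree : graph;
  bag : td_tree -> {set G};
  td_treeP : is_tree td_tree;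
  bag_vertex : forall u : G, exists t, u \in bag t;
  bag_edge : forall u v : G, edge u v -> exists t, (u \in bag t) && (v \in bag t);
  bag_connected : forall u : G, connected_graph (induced [set t | u \in bag t]) }.

Definition td_alpha (G : graph) (D : tree_decomposition G) : nat :=
  \max_(t : td_tree D) alpha (induced (bag t)).

Section TrivialDecomposition.
Variable G : graph.

Definition point_graph : graph :=
  @Graph unit (fun _ _ => false) (fun _ _ => erefl) (fun _ => erefl).

Lemma point_graph_tree : is_tree point_graph.
Proof.
split; first by rewrite card_unit.
- by move=> [] []; exact: connect0.
- by case=> [//|x [//|y s]] /andP[].
Qed.

Lemma trivial_bag_connected (u : G) :
  connected_graph
    (induced [set t : point_graph | u \in (fun=> [set: G]) t]).
Proof.
move=> [[] i] [[] j]; rewrite (bool_irrelevance i j); exact: connect0.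
Qed.

Definition trivial_decomposition : tree_decomposition G :=
  @TreeDecomposition G point_graph (fun=> [set: G]) point_graph_tree
    (fun u => ex_intro _ tt (finset.in_setT u))
    (fun u v _ => ex_intro _ tt (introT andP (conj (finset.in_setT u) (finset.in_setT v))))
    trivial_bag_connected.

Lemma td_alpha_exists :
  exists k, `[< exists D : tree_decomposition G, td_alpha D = k >].
Proof.
by exists (td_alpha trivial_decomposition); apply/asboolP;
  exists trivial_decomposition.
Qed.

End TrivialDecomposition.

Definition tree_alpha (G : graph) : nat := ex_minn (td_alpha_exists G).

Section Segments.
Variable R : realType.
Local Open Scope ring_scope.
Local Open Scope classical_set_scope.

Record segment := Segment {
  endpoint1 : 'rV[R]_2;
  endpoint2 : 'rV[R]_2;
  endpoints_neq : endpoint1 != endpoint2 }.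

Definition points (s : segment) : set 'rV[R]_2 :=
  [set x | exists t : R, 0 <= t <= 1 /\
    x = (1 - t) *: endpoint1 s + t *: endpoint2 s].

Definition seg_interior (s : segment) : set 'rV[R]_2 :=
  points s `\` [set endpoint1 s; endpoint2 s].

(* The segments are indexed by the vertices.  Distinct vertices automatically
   get distinct segments: interiors are nonempty, so equal segments do not have
   disjoint interiors. *)
Definition contact_segment_graph (G : graph) : Prop :=
  exists s : G -> segment,
    (forall u v : G, u != v -> seg_interior (s u) `&` seg_interior (s v) = set0) /\
    (forall u v : G, edge u v <-> u != v /\ points (s u) `&` points (s v) !=set0).

End Segments.

(* Main.v *)
(* Take a comb: a vertical spine with n long horizontal teeth, and between
   consecutive teeth n unit vertical segments, aligned in n columns.  Crossings
   never occur because the columns are cut at the teeth.  Every segment is within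
   distance 2 of the spine.  Contracting each column to a vertex gives K_{n,n}
   as an induced minor, since each column touches each tooth.  In a tree
   decomposition the teeth and the columns give two families of n subtrees, each
   member of one meeting each member of the other; hence all members of one of the
   families share a node, whose bag contains n pairwise nonadjacent segments. *)
Require Import Defs.
From mathcomp Require Import all_boot all_order all_algebra.
From mathcomp Require Import boolp classical_sets reals.
From mathcomp Require Import ring lra.

Set Implicit Arguments.
Unset Strict Implicit.
Unset Printing Implicit Defensive.

Import Order.TTheory GRing.Theory Num.Theory.

(** * Connectivity in induced subgraphs *)

Definition within (G : graph) (A : {set G}) : rel G :=
  [rel u v | [&& edge u v, u \in A & v \in A]].

(** [within] stays on the vertex type of [G], so later arguments compare and concatenate walks
    without subtypes. Walks project along [val] and lift vertex by vertex. *)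
Lemma connected_inducedP (G : graph) (A : {set G}) :
  connected_graph (induced A) <-> {in A &, forall x y, connect (within A) x y}.
Proof.
split=> [conA x y xA yA | conA [x xA] [y yA]].
  have /connectP[p pp lp] := conA (Sub x xA) (Sub y yA).
  apply/connectP; exists (map val p); last first.
    by rewrite -[x]/(val (Sub x xA : induced A)) last_map -lp.
  rewrite -[x]/(val (Sub x xA : induced A)).
  apply: (homo_path _ pp) => u v uv.
  by apply/and3P; split; [exact: uv | exact: valP | exact: valP].
have /connectP[p pp lp] := conA x y xA yA.
elim: p x xA pp lp => [|z p IH] x xA /=.
  by move=> _ yx; subst y; rewrite (bool_irrelevance xA yA) connect0.
move=> /andP[/and3P[xz _ zA] pp] lp.
by apply: connect_trans (connect1 _) (IH z zA pp lp).
Qed.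

(** * Separation and subtrees in trees *)

Definition avoid (G : graph) (t : G) : rel G :=
  [rel u v | [&& edge u v, u != t & v != t]].

Lemma avoid_connect_sym (G : graph) (t : G) : connect_sym (avoid t).
Proof.
by apply: sym_connect_sym => u v; rewrite /avoid /= edge_sym [(v != t) && _]andbC.
Qed.

Lemma connect_avoid (G : graph) (A : {set G}) (t x y : G) :
  connected_graph (induced A) -> x \in A -> y \in A -> t \notin A ->
  connect (avoid t) x y.
Proof.
move=> /connected_inducedP conA xA yA tA.
apply: connect_sub (conA x y xA yA) => u v /and3P[uv uA vA].
by apply: connect1; rewrite /avoid /= uv !(memPn tA).
Qed.

(** The first walk never enters [t] and the second, reversed, never leaves [t'], so joined they lead
    from [t'] to [t] without the step [(t', t)]. Made simple, this walk has at least two steps, and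
    the edge from [t] to [t'] closes it to a cycle of size at least 3. *)
Lemma acyclic_bridge (T : graph) (t t' x : T) :
  acyclic T -> edge t t' ->
  connect (avoid t) t' x -> connect (avoid t') t x -> False.
Proof.
move=> acT ett' c1 c2.
pose e' := [rel u v | edge u v && ((u, v) != (t', t))].
have sub1 : connect e' t' x.
  apply: connect_sub c1 => u v /and3P[uv ut vt]; apply: connect1 => /=.
  by rewrite uv xpair_eqE (negPf vt) andbF.
have sub2 : connect e' x t.
  move: c2; rewrite avoid_connect_sym; apply: connect_sub => u v /and3P[uv ut vt].
  by apply: connect1 => /=; rewrite uv xpair_eqE (negPf ut).
have /connectP[p pp lp] := connect_trans sub1 sub2.
case/shortenP: pp lp => q pq uq _ lq.
have pq' : path (@edge T) t' q by apply: sub_path pq => u v /andP[].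
have /acT : ucycle (@edge T) (t' :: q).
  by rewrite /ucycle uq andbT /= rcons_path pq' -lq.
case: q pq lq {uq pq'} => [|y [|//]] /=.
  by move=> _ tt; rewrite tt edge_irrefl in ett'.
by rewrite andbT => /andP[_ yt] ty; rewrite ty eqxx in yt.
Qed.

Lemma ex_periodic (T : finType) (g : T -> T) (x : T) :
  exists y k, iter k.+1 g y = y.
Proof.
have /trajectP[i lt_i e] := looping_order g x.
(* The iterate of index [order g x] repeats that of index [i], so the difference is a positive
   period; [.-1] matches the form [k.+1]. *)
exists (iter i g x), (order g x - i).-1.
by rewrite prednK ?subn_gt0 // -iterD (subnK (ltnW lt_i)).
Qed.

(** The orbit of a periodic point is a closed walk without repeated vertices. Acyclicity leaves size
    1, excluded by irreflexivity, or size 2, which is backtracking. *)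
Lemma acyclic_map_backtracks (T : graph) (g : T -> T) (x : T) :
  acyclic T -> (forall t, edge t (g t)) -> exists t, g (g t) = t.
Proof.
move=> acT eg; have [y [k yk]] := ex_periodic g x.
have cyc : fcycle g (orbit g y) by apply: (iffRL (orbitPcycle 0 3)); exists k.
have := acT (orbit g y).
rewrite /ucycle orbit_uniq andbT (sub_cycle _ cyc); last first.
  by move=> u v /eqP <-.
move=> /(_ isT) sz; exists y; move: cyc sz.
case: (orbit g y) (in_orbit g y) => [//|a [|b [|//]]] /=; rewrite !inE.
  by move=> _ /andP[/eqP gaa _]; have := eg a; rewrite gaa edge_irrefl.
by case/orP=> /eqP -> /and3P[/eqP ga /eqP gb _] _; rewrite ?(ga, gb).
Qed.

(* If no node is good, every [t] misses some [A i] and some [B j].  Map [t] to its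
   neighbour [t'] towards a point of [A i :&: B j].  This map backtracks on some
   edge [t t']; then the [A i] missing [t] and the [B j'] missing [t'] lie on
   opposite sides of that edge, yet they meet. *)
Lemma subtree_biclique (T : graph) (I J : finType)
    (A : I -> {set T}) (B : J -> {set T}) :
  is_tree T ->
  (forall i, connected_graph (induced (A i))) ->
  (forall j, connected_graph (induced (B j))) ->
  (forall i j, exists x, x \in A i /\ x \in B j) ->
  (exists t, forall i, t \in A i) \/ (exists t, forall j, t \in B j).
Proof.
move=> [/card_gt0P[t0 _] conT acT] conA conB AB.
case: (boolP [exists t, [forall i, t \in A i]]) => [|noA].
  by move=> /existsP[t /forallP]; left; exists t.
case: (boolP [exists t, [forall j, t \in B j]]) => [|noB].
  by move=> /existsP[t /forallP]; right; exists t.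
exfalso.
have missed t : exists w : I * J * T * T,
    let: (i, j, x, t') := w in
    [/\ t \notin A i, t \notin B j, x \in A i, x \in B j & edge t t'] /\
    connect (avoid t) t' x.
  have /existsP[i tA] : [exists i, t \notin A i].
    by move: noA; rewrite negb_exists => /forallP/(_ t); rewrite negb_forall.
  have /existsP[j tB] : [exists j, t \notin B j].
    by move: noB; rewrite negb_exists => /forallP/(_ t); rewrite negb_forall.
  have [x [xA xB]] := AB i j.
  have /connectP[p pp] := conT t x; case/shortenP: pp => q pq uq _.
  case: q pq uq => [_ _ /= xt|t' q /= /andP[tt' pq] /andP[tq uq] lq].
    by rewrite xt (negPf tA) in xA.
  exists (i, j, x, t'); split=> //; apply/connectP; exists q => //.
  have : all (predC1 t) (t' :: q).
    by apply/allP => z zq; apply: contraNneq tq => <-.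
  elim: q t' pq {tt' tq uq lq} => //= y q IH t' /andP[ty pq] /and3P[nt ny al].
  by rewrite IH /= ?ny // /avoid /= ty nt ny.
have [w wP] := choice missed.
have edge_w t : edge t (w t).2.
  by have := wP t; case: (w t) => [[[i j] x] t'] [[]].
have [t] := acyclic_map_backtracks t0 acT edge_w.
have := wP t; case: (w t) => [[[i j] x] t'] /= [[tA _ xA _ tt'] c1].
have := wP t'; case: (w t') => [[[i' j'] x'] t''] /= [[_ tB _ xB _] c2] ett.
rewrite {t''}ett in c2.
have [y [yA yB]] := AB i j'.
apply: (acyclic_bridge acT tt' (x := y)).
  exact: connect_trans c1 (connect_avoid (conA i) xA yA tA).
exact: connect_trans c2 (connect_avoid (conB j') xB yB tB).
Qed.

(** * Lower bounds on the tree-independence number *)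

Lemma alpha_induced_ge (G : graph) (A : {set G}) n (h : 'I_n -> G) :
  (forall i, h i \in A) -> injective h -> (forall i j, ~~ edge (h i) (h j)) ->
  n <= alpha (induced A).
Proof.
move=> hA injh nedge.
pose k i : induced A := Sub (h i) (hA i).
have injk : injective k by move=> i j /(congr1 val) /injh.
have stk : stable [set k i | i in 'I_n]%SET.
  apply/forall_inP => _ /imsetP[i _ ->]; apply/forall_inP => _ /imsetP[j _ ->].
  exact: nedge.
have := @leq_bigmax_cond _ (@stable _) (fun S : {set induced A} => #|S|) _ stk.
by rewrite card_imset // card_ord.
Qed.

Lemma tree_alpha_ge (G : graph) n :
  (forall D : tree_decomposition G, exists t : td_tree D,
     n <= alpha (induced (bag t))) -> n <= tree_alpha G.
Proof.
move=> H; rewrite /tree_alpha; case: ex_minnP => _ /asboolP[D <-] _.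
by have [t nt] := H D; apply: leq_trans nt _; exact: leq_bigmax.
Qed.

Definition nodes_meeting (G : graph) (D : tree_decomposition G) (W : {set G}) :
  {set td_tree D} := [set t | [exists u in W, u \in bag t]].

(** The nodes of each single vertex are connected, and for adjacent vertices these node sets share a
    node whose bag holds the edge. A walk in [W] thus chains overlapping connected sets. *)
Lemma connected_nodes_meeting (G : graph) (D : tree_decomposition G) (W : {set G}) :
  connected_graph (induced W) -> connected_graph (induced (nodes_meeting D W)).
Proof.
move=> /connected_inducedP conW; apply/connected_inducedP => x y.
rewrite !inE => /exists_inP[u uW ux] /exists_inP[v vW vy].
have one w a b : w \in W -> w \in bag a -> w \in bag b ->
    connect (within (nodes_meeting D W)) a b.
  move=> wW wa wb.
  have /connected_inducedP/(_ a b) := @bag_connected _ D w.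
  rewrite !inE => /(_ wa wb); apply: connect_sub => c d /and3P[cd].
  rewrite !inE => wc wd; apply: connect1; rewrite /within /= cd !inE /=.
  by apply/andP; split; apply/exists_inP; exists w.
have /connectP[p] := conW u v uW vW.
elim: p u x uW ux => [|w p IH] u x uW ux /=.
  by move=> _ vu; apply: (one v); rewrite // vu.
move=> /andP[/and3P[uw _ wW] pp] lp.
have [t /andP[ut wt]] := bag_edge D uw.
exact: connect_trans (one _ _ _ uW ux ut) (IH _ _ wW wt pp lp).
Qed.

Definition anticomplete (G : graph) (A B : {set G}) : Prop :=
  {in A & B, forall a b, a != b /\ ~~ edge a b}.

(** One representative in [A] is chosen from each [P i]; anticompleteness makes them distinct as
    well as nonadjacent. *)
Lemma transversal_alpha (G : graph) n (P : 'I_n -> {set G}) (A : {set G}) :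
  (forall i j, i != j -> anticomplete (P i) (P j)) ->
  (forall i, exists2 u, u \in P i & u \in A) -> n <= alpha (induced A).
Proof.
move=> antiP PA.
have [h hP] := choice (fun i => let: ex_intro2 u uP uA := PA i in
  ex_intro (fun u => u \in P i /\ u \in A) u (conj uP uA)).
have hPi i := (hP i).1.
apply: (alpha_induced_ge (h := h)) => [i|i j hij|i j]; first by case: (hP i).
  apply: contraTeq isT => neq.
  by have [] := antiP _ _ neq _ _ (hPi i) (hPi j); rewrite hij eqxx.
have [->|neq] := eqVneq i j; first by rewrite edge_irrefl.
by have [] := antiP _ _ neq _ _ (hPi i) (hPi j).
Qed.

(* The hypotheses say that K_{n,n} is an induced minor of [G]. *)
Lemma biclique_minor_tree_alpha (G : graph) n (P Q : 'I_n -> {set G}) :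
  (forall i, connected_graph (induced (P i))) ->
  (forall j, connected_graph (induced (Q j))) ->
  (forall i j, exists u v, [/\ u \in P i, v \in Q j & edge u v]) ->
  (forall i j, i != j -> anticomplete (P i) (P j)) ->
  (forall i j, i != j -> anticomplete (Q i) (Q j)) ->
  n <= tree_alpha G.
Proof.
move=> conP conQ PQ antiP antiQ; apply: tree_alpha_ge => D.
have [|||[t tP]|[t tQ]] := @subtree_biclique _ _ _
    (fun i => nodes_meeting D (P i)) (fun j => nodes_meeting D (Q j)) (td_treeP D).
- by move=> i; exact: connected_nodes_meeting.
- by move=> j; exact: connected_nodes_meeting.
- move=> i j; have [u [v [uP vQ /(bag_edge D)[t /andP[ut vt]]]]] := PQ i j.
  by exists t; rewrite !inE; split; apply/exists_inP; [exists u | exists v].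
- exists t; apply: transversal_alpha antiP _ => i.
  by have := tP i; rewrite inE => /exists_inP.
- exists t; apply: transversal_alpha antiQ _ => i.
  by have := tQ i; rewrite inE => /exists_inP.
Qed.

Lemma connected_set1 (G : graph) (x : G) : connected_graph (induced [set x]%SET).
Proof.
by apply/connected_inducedP => u v; rewrite !inE => /eqP-> /eqP->; exact: connect0.
Qed.

(** Serves for the columns of the comb, whose unit segments touch consecutively. *)
Lemma connected_walk (G : graph) n (v : 'I_n -> G) :
  (forall i j : 'I_n, j = i.+1 :> nat -> edge (v i) (v j)) ->
  connected_graph (induced [set v i | i in 'I_n]%SET).
Proof.
move=> vE; apply/connected_inducedP; set W := imset _ _.
have symW : connect_sym (within W).
  by apply: sym_connect_sym => a b; rewrite /within /= edge_sym [(b \in W) && _]andbC.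
have vW i : v i \in W by apply: imset_f.
have up (i j : 'I_n) : i <= j -> connect (within W) (v i) (v j).
  case: j => j ltj /= le_ij; elim: j ltj le_ij => [|j IH] ltj.
    by rewrite leqn0 => /eqP i0; rewrite (_ : Ordinal ltj = i) //; exact: val_inj.
  rewrite leq_eqVlt => /predU1P[ij|lt_ij].
    by rewrite (_ : Ordinal ltj = i) //; exact: val_inj.
  apply: connect_trans (IH (ltnW ltj) lt_ij) (connect1 _).
  by rewrite /within /= vE ?vW.
move=> _ _ /imsetP[i _ ->] /imsetP[j _ ->].
by case/orP: (leq_total i j) => /up //; rewrite symW.
Qed.

(** * Contact graphs of families of segments *)

Section ContactGraph.
Variables (R : realType) (V : finType) (s : V -> segment R).

Definition contact_edge : rel V :=
  fun u v => (u != v) && `[< (points (s u) `&` points (s v) !=set0)%classic >].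

Lemma contact_edge_sym : symmetric contact_edge.
Proof. by move=> u v; rewrite /contact_edge eq_sym setIC. Qed.

Lemma contact_edge_irrefl : irreflexive contact_edge.
Proof. by move=> u; rewrite /contact_edge eqxx. Qed.

Definition contact_graph : graph := Graph contact_edge_sym contact_edge_irrefl.

Lemma contact_edgeI (u v : V) (x : 'rV[R]_2) :
  u != v -> points (s u) x -> points (s v) x -> @edge contact_graph u v.
Proof. by move=> uv xu xv; apply/andP; split=> //; apply/asboolP; exists x. Qed.

Lemma contact_graphP :
  (forall u v x, seg_interior (s u) x -> seg_interior (s v) x -> u = v) ->
  contact_segment_graph R contact_graph.
Proof.
move=> disj; exists s; split=> u v.
  move=> /eqP uv; apply/seteqP; split=> // x [xu xv]; exact/uv/(disj _ _ x).
by split=> [/andP[uv /asboolP]|[uv ?]]; [split | apply/andP; split=> //; apply/asboolP].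
Qed.

End ContactGraph.

(** * The comb and its adjacencies *)

Section Comb.
Variables (R : realType) (n : nat).
Hypothesis n_gt0 : 0 < n.
Local Open Scope ring_scope.

Definition lattice_point (p : nat * nat) : 'rV[R]_2 :=
  \row_k (if k == ord0 then p.1%:R else p.2%:R).

Lemma lattice_point_inj : injective lattice_point.
Proof.
move=> [a b] [c d] /rowP e; have := e ord_max; have := e ord0; rewrite !mxE /=.
by move=> /eqP; rewrite eqr_nat => /eqP -> /eqP; rewrite eqr_nat => /eqP ->.
Qed.

(* The spine [None] is the segment from (0,0) to (0,n), the tooth [inl i] that
   from (0,i) to (n,i), and [inr (i, j)] that from (j+1,i) to (j+1,i+1). *)
Definition comb_vertex : finType := option ('I_n + 'I_n * 'I_n).

Definition comb_start (u : comb_vertex) : nat * nat :=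
  match u with
  | None => (0, 0)%N
  | Some (inl i) => (0%N, i : nat)
  | Some (inr (i, j)) => (j.+1, i : nat)
  end.

Definition comb_end (u : comb_vertex) : nat * nat :=
  match u with
  | None => (0%N, n)
  | Some (inl i) => (n, i : nat)
  | Some (inr (i, j)) => (j.+1, i.+1)
  end.

Lemma comb_endpoints_neq u :
  lattice_point (comb_start u) != lattice_point (comb_end u).
Proof.
rewrite (inj_eq lattice_point_inj).
case: u => [[i|[i j]]|]; rewrite /= xpair_eqE ?eqxx /= ?andbT.
- by rewrite eq_sym -lt0n.
- by rewrite neq_ltn ltnSn.
- by rewrite eq_sym -lt0n.
Qed.

Definition comb_segment (u : comb_vertex) : segment R :=
  Segment (comb_endpoints_neq u).

Lemma points_combP u x : points (comb_segment u) x <-> exists t : R,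
  [/\ 0 <= t <= 1,
    x ord0 ord0 = (1 - t) * (comb_start u).1%:R + t * (comb_end u).1%:R &
    x ord0 ord_max = (1 - t) * (comb_start u).2%:R + t * (comb_end u).2%:R].
Proof.
split=> [[t [t01 ->]]|[t [t01 x0 x1]]]; first by exists t; rewrite !mxE.
exists t; split=> //; apply/rowP => k; rewrite !mxE /=.
have [->//|k0] := eqVneq k ord0.
by rewrite -x1; congr (x ord0 _); apply: val_inj; case: k k0 => [[|[|]]].
Qed.

Lemma comb_interior u x : seg_interior (comb_segment u) x -> exists t : R,
  [/\ 0 < t < 1,
    x ord0 ord0 = (1 - t) * (comb_start u).1%:R + t * (comb_end u).1%:R &
    x ord0 ord_max = (1 - t) * (comb_start u).2%:R + t * (comb_end u).2%:R].
Proof.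
move=> [[t [/andP[t0 t1] ->]] notend]; exists t; rewrite !mxE; split=> //.
rewrite !lt_neqAle t0 t1 !andbT eq_sym; apply/andP; split.
  by apply: contra_notN notend => /eqP ->; left; rewrite subr0 scale1r scale0r addr0.
by apply: contra_notN notend => /eqP ->; right; rewrite subrr scale1r scale0r add0r.
Qed.

(** Simple regions that contain the segment interiors and are still pairwise disjoint: a full line
    for the spine, an open ray for a tooth, the exact interior for a unit segment. *)
Definition comb_cell (u : comb_vertex) (x y : R) : Prop :=
  match u with
  | None => x = 0
  | Some (inl i) => 0 < x /\ y = i%:R
  | Some (inr (i, j)) => x = j.+1%:R /\ i%:R < y < i.+1%:R
  end.

Lemma comb_interior_cell u x :
  seg_interior (comb_segment u) x -> comb_cell u (x ord0 ord0) (x ord0 ord_max).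
Proof.
move=> /comb_interior[t []]; case: u => [[i|[i j]]|] /= => /andP[t0 t1] -> y_t; rewrite ?y_t.
- by rewrite mulr0 add0r mulr_gt0 ?ltr0n //; split=> //; ring.
- by rewrite -[i.+1]addn1 natrD; split; [ring | apply/andP; split; lra].
- by ring.
Qed.

(** The abscissa separates the spine from the rest and the columns from each other. The height
    separates teeth, unit segments of one column, and, as integers avoid the open intervals
    [(i, i+1)], teeth from columns. *)
Lemma comb_cell_disjoint u v (x y : R) : comb_cell u x y -> comb_cell v x y -> u = v.
Proof.
have nat_cell i k : k%:R = y -> i%:R < y < i.+1%:R -> False.
  by move=> <-; rewrite !ltr_nat ltnS => /andP[/leq_trans/[apply]]; rewrite ltnn.
have cell_inj i j : i%:R < y < i.+1%:R -> j%:R < y < j.+1%:R -> i = j.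
  move=> /andP[iy yi] /andP[jy yj]; apply/eqP.
  move: (lt_trans iy yj) (lt_trans jy yi); rewrite !ltr_nat !ltnS => ij ji.
  by rewrite eqn_leq ij.
have Sj0 j : 0 <> j.+1%:R :> R by move/eqP; rewrite eq_sym pnatr_eq0.
case: u => [[i|[i j]]|]; case: v => [[i'|[i' j']]|] //=.
- by move=> [_ ->] [_ /eqP]; rewrite eqr_nat => /eqP/val_inj ->.
- by move=> [_ yi] [_ yi']; case: (nat_cell i' i).
- by move=> [x0 _] xe; rewrite xe ltxx in x0.
- by move=> [_ yi] [_ yi']; case: (nat_cell i i').
- move=> [-> yi] [/eqP]; rewrite eqr_nat eqSS => /eqP/val_inj -> yi'.
  by have /val_inj -> := cell_inj _ _ yi yi'.
- by move=> [-> _] /esym/Sj0.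
- by move=> xe [x0 _]; rewrite xe ltxx in x0.
- by move=> -> [/Sj0].
Qed.

Definition comb_graph : graph := contact_graph comb_segment.

Lemma comb_contact : contact_segment_graph R comb_graph.
Proof.
by apply: contact_graphP => u v x /comb_interior_cell xu /comb_interior_cell;
  exact: comb_cell_disjoint.
Qed.

Lemma tooth_point (i : 'I_n) k :
  (k <= n)%N -> points (comb_segment (Some (inl i))) (lattice_point (k, i : nat)).
Proof.
move=> kn; apply/points_combP; have n0 : 0 < n%:R :> R by rewrite ltr0n.
(* The tooth has length [n] and starts at abscissa 0, so abscissa [k] is reached at parameter
   [k / n]. *)
exists (k%:R / n%:R); rewrite !mxE /=; split.
- by rewrite divr_ge0 ?ler0n // ler_pdivrMr // mul1r ler_nat.
- by rewrite mulr0 add0r divfK // gt_eqF.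
- by ring.
Qed.

Lemma spine_point k : (k <= n)%N -> points (comb_segment None) (lattice_point (0%N, k)).
Proof.
move=> kn; apply/points_combP; have n0 : 0 < n%:R :> R by rewrite ltr0n.
exists (k%:R / n%:R); rewrite !mxE /=; split.
- by rewrite divr_ge0 ?ler0n // ler_pdivrMr // mul1r ler_nat.
- by ring.
- by rewrite mulr0 add0r divfK // gt_eqF.
Qed.

Lemma column_point0 (i j : 'I_n) :
  points (comb_segment (Some (inr (i, j)))) (lattice_point (j.+1, i : nat)).
Proof. by apply/points_combP; exists 0; rewrite !mxE /=; split; [lra|ring|ring]. Qed.

Lemma column_point1 (i j : 'I_n) :
  points (comb_segment (Some (inr (i, j)))) (lattice_point (j.+1, i.+1)).
Proof. by apply/points_combP; exists 1; rewrite !mxE /=; split; [lra|ring|ring]. Qed.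

Lemma edge_spine_tooth (i : 'I_n) : @edge comb_graph None (Some (inl i)).
Proof.
exact: contact_edgeI (spine_point (ltnW (ltn_ord i))) (tooth_point i (leq0n n)).
Qed.

Lemma edge_tooth_column (i j : 'I_n) :
  @edge comb_graph (Some (inl i)) (Some (inr (i, j))).
(* [ltn_ord j] is read as [j.+1 <= n]: the tooth reaches every column, the last one at its tip. *)
Proof. exact: contact_edgeI (tooth_point i (ltn_ord j)) (column_point0 i j). Qed.

Lemma edge_column (i i' j : 'I_n) : i' = i.+1 :> nat ->
  @edge comb_graph (Some (inr (i, j))) (Some (inr (i', j))).
Proof.
move=> ii'; apply: contact_edgeI (column_point1 i j) _.
  by apply/eqP => -[e]; move: ii'; rewrite -e => /n_Sn.
by rewrite -ii'; exact: column_point0.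
Qed.

(** A tooth has constant height, so a common point would have two heights; columns are treated
    likewise through their abscissas. *)
Lemma non_edge_teeth (i i' : 'I_n) :
  i != i' -> ~~ @edge comb_graph (Some (inl i)) (Some (inl i')).
Proof.
move=> /eqP neq; apply/negP => /andP[_ /asboolP[x [/points_combP xi /points_combP xi']]].
case: xi xi' => [t [_ _ /= ->]] [t' [_ _ /=]].
rewrite -!mulrDl !subrK !mul1r => /eqP; rewrite eqr_nat => /eqP/val_inj.
exact: neq.
Qed.

Lemma non_edge_columns (i i' j j' : 'I_n) :
  j != j' -> ~~ @edge comb_graph (Some (inr (i, j))) (Some (inr (i', j'))).
Proof.
move=> /eqP neq; apply/negP => /andP[_ /asboolP[x [/points_combP xi /points_combP xi']]].
case: xi xi' => [t [_ /= -> _]] [t' [_ /= + _]].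
rewrite -!mulrDl !subrK !mul1r => /eqP; rewrite eqr_nat eqSS => /eqP/val_inj.
exact: neq.
Qed.

(** The unit segment [(i, j)] stands on tooth [i], which meets the spine. Restricting to the ball
    therefore loses no vertex. *)
Lemma ball_comb (u : comb_graph) : u \in ball 2 (None : comb_graph).
Proof.
have walk (p : seq comb_graph) : (size p <= 2)%N -> path (@edge comb_graph) None p ->
    last None p \in ball 2 (None : comb_graph).
  by move=> szp pp; rewrite inE; apply/existsP; exists (Bseq szp); rewrite /= pp eqxx.
case: u => [[i|[i j]]|].
- by apply: (walk [:: Some (inl i)]) => //; apply/andP; split=> //; exact: edge_spine_tooth.
- apply: (walk [:: Some (inl i); Some (inr (i, j))]) => //.
  by apply/and3P; split=> //; [exact: edge_spine_tooth | exact: edge_tooth_column].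
- exact: (walk [::]).
Qed.

Lemma comb_tree_alpha : (n <= tree_alpha (induced (ball 2 (None : comb_graph))))%N.
Proof.
set H := induced _; pose inH (u : comb_graph) : H := Sub u (ball_comb u).
pose tooth i := inH (Some (inl i)); pose column i j := inH (Some (inr (i, j))).
apply: (biclique_minor_tree_alpha (P := fun i => [set tooth i]%SET)
    (Q := fun j => [set column i j | i in 'I_n]%SET)).
- by move=> i; exact: connected_set1.
- by move=> j; apply: connected_walk => i i'; exact: edge_column.
(* Tooth [i] meets column [j] in the foot of the unit segment [(i, j)]. *)
- move=> i j; exists (tooth i), (column i j); split; first exact/set11.
    exact: imset_f.
  exact: edge_tooth_column.
- move=> i i' ii' _ _ /set1P -> /set1P ->; split; last exact: non_edge_teeth.
  by apply: contraNneq ii' => /(congr1 val) [->].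
- move=> j j' jj' _ _ /imsetP[i _ ->] /imsetP[i' _ ->].
  split; last exact: non_edge_columns.
  by apply: contraNneq jj' => /(congr1 val) [_ ->].
Qed.

End Comb.

Theorem proposition3p9 (R : realType) :
  ~ exists f : nat -> nat,
      forall (r : nat) (G : graph),
        contact_segment_graph R G ->
        forall v : G, tree_alpha (induced (ball r v)) <= f r.
Proof.
(* The radius 2 does not depend on the size of the comb, so size [(f 2).+1] exceeds the supposed
   bound. *)
move=> [f fP]; pose n_gt0 := ltn0Sn (f 2).
have := fP 2 _ (comb_contact R n_gt0) None.
by rewrite leqNgt (leq_trans _ (comb_tree_alpha R n_gt0)).
Qed.
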